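(* Let $n$ and $k$ be integers with $k\ge 1$ and $n\ge 2k+1$. Then the (vertex) connectivity of the bipartite Kneser graph $H(n,k)$ is maximum, namely, it equals $\binom{n-k}{k}$.
   Context: For a positive integer $n$, let $[n]=\{1,2,\dots,n\}$. For integers $k\ge 1$ and $n\ge 2k+1$, the bipartite Kneser graph $H(n,k)$ is the simple graph whose vertices are all the $k$-element subsets and all the $(n-k)$-element subsets of $[n]$, two distinct vertices $A,B$ being adjacent if and only if $A\subset B$ or $B\subset A$. This graph is regular of degree $\binom{n-k}{k}$; ''maximum'' connectivity means that the connectivity equals this degree. The connectivity of a (non-complete) connected graph is the minimum number of vertices whose removal disconnects it. *)

(* Defs.v *)
From mathcomp Require Import all_boot.

Set Implicit Arguments.
Unset Strict Implicit.
Unset Printing Implicit Defensive.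

(* Simple graphs are given by a symmetric irreflexive [e : rel T] on a finType. *)
Section Graph.
Variables (T : finType) (e : rel T).

Definition degree (x : T) : nat := #|[set y | e x y]|.

Definition del (S : {set T}) : rel T :=
  [rel u v | [&& u \notin S, v \notin S & e u v]].

Definition disconnecting (S : {set T}) : bool :=
  [exists x, exists y, [&& x \notin S, y \notin S & ~~ connect (del S) x y]].

(* The default [#|T|.-1] is the usual convention for complete graphs, which have
   no disconnecting set. It is irrelevant otherwise, since a disconnecting set
   has at most [#|T| - 2] elements. *)
Definition connectivity : nat :=
  \big[minn/#|T|.-1]_(S : {set T} | disconnecting S) #|S|.

Definition maximum_connectivity : Prop :=
  forall x : T, connectivity = degree x.

End Graph.

Section BipartiteKneser.
Variables (n k : nat).

(* The ground set {1, ..., n} is represented by ['I_n] = {0, ..., n-1}. *)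
Definition bkneser_vertex :=
  {A : {set 'I_n} | (#|A| == k) || (#|A| == n - k)}.

Definition bkneser : rel bkneser_vertex :=
  [rel A B : bkneser_vertex | (A != B) && ((val A \subset val B) || (val B \subset val A))].

Lemma bkneser_sym : symmetric bkneser.
Proof. by move=> A B; rewrite /bkneser /= eq_sym orbC. Qed.

Lemma bkneser_irr : irreflexive bkneser.
Proof. by move=> A; rewrite /bkneser /= eqxx. Qed.

End BipartiteKneser.

(* Main.v *)
Require Import Defs.
From mathcomp Require Import all_boot.
From mathcomp Require Import fingroup perm zify.

Set Implicit Arguments.
Unset Strict Implicit.
Unset Printing Implicit Defensive.

(** The upper bound is the usual one: the neighbours of a vertex [u] separate
    [u] from any other vertex of the same cardinality.

    The lower bound uses the atoms of Mader and Watkins.  Call a set [X] of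
    vertices separating when it is nonempty and some vertex is neither in [X]
    nor adjacent to it; every disconnecting set contains the boundary of a
    separating set ([disconnecting_boundary]).  An atom is a separating set
    with the smallest boundary and, among those, with the fewest elements.
    Submodularity of the size of the boundary implies that two atoms that meet
    are equal ([atoms_disjoint]), so an automorphism that fixes a vertex of an
    atom preserves the atom ([atom_stable]).

    Suppose that an atom of the bipartite Kneser graph contains an edge
    [U \subset W].  A transposition of the ground set that fixes [U] or [W]
    preserves the atom, and all the other transpositions are conjugates of
    these by one another.  So the atom is invariant under every permutation of
    the ground set; as it has vertices of both cardinalities, it contains every
    vertex, which is absurd for a separating set
    ([bkneser_atom_edgeless]).  Hence atoms contain no edge, all the neighbours
    of a vertex of an atom lie in the boundary of the atom, and this boundary
    has at least as many elements as the degree ([edgeless_atoms_bound]). *)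

(** * Separating sets and atoms of a finite graph *)

Section Atoms.
Variables (T : finType) (e : rel T).
Hypothesis e_sym : symmetric e.
Implicit Types (X Y Z A B S : {set T}).

Definition boundary X : {set T} :=
  [set y | (y \notin X) && [exists x in X, e x y]].

Definition far X : {set T} := ~: (X :|: boundary X).

Definition separating X : bool := (X != set0) && (far X != set0).

(** The boundary of an atom has the size of a minimum vertex cut; the second
    clause makes an atom smallest among the sets with such a boundary. *)
Definition atom A : Prop :=
  separating A /\
  forall X, separating X ->
    #|boundary A| <= #|boundary X| /\
    (#|boundary X| = #|boundary A| -> #|A| <= #|X|).

Lemma in_boundary X y :
  (y \in boundary X) = (y \notin X) && [exists x in X, e x y].
Proof. by rewrite inE. Qed.

Lemma in_far X y : (y \in far X) = (y \notin X) && ~~ [exists x in X, e x y].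
Proof.
by rewrite !inE; case: (y \in X) => //=.
Qed.

Lemma far_no_edge X x y : x \in X -> y \in far X -> ~~ e x y.
Proof.
move=> xX; rewrite in_far => /andP[_]; apply: contra => exy.
by apply/existsP; exists x; rewrite xX.
Qed.

Lemma far_antimono X Y : X \subset Y -> far Y \subset far X.
Proof.
move=> /subsetP sXY; apply/subsetP => y; rewrite !in_far => /andP[yY nE].
rewrite (contra (sXY y) yY); apply: contra nE => /existsP[x /andP[xX exy]].
by apply/existsP; exists x; rewrite sXY.
Qed.

Lemma sub_far_far X : X \subset far (far X).
Proof.
apply/subsetP => x xX; rewrite in_far; apply/andP; split.
  by rewrite in_far xX.
apply/existsP => -[y /andP[yF]]; rewrite e_sym.
by apply/negP; apply: far_no_edge yF.
Qed.

(** A vertex of [X] is adjacent to no vertex of [far X], so only vertices of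
    [boundary X] can be adjacent to [far X] from outside. *)
Lemma boundary_far X : boundary (far X) \subset boundary X.
Proof.
apply/subsetP => y; rewrite in_boundary => /andP[yF /existsP[x /andP[xF exy]]].
move: yF; rewrite !inE negbK => /orP[yX|//].
by have := far_no_edge yX xF; rewrite e_sym exy.
Qed.

Lemma card_trisect X Z :
  #|Z| = #|Z :&: X| + #|Z :&: boundary X| + #|Z :&: far X|.
Proof.
rewrite -(cardsID (X :|: boundary X) Z) setDE; congr (_ + _).
rewrite setIUr cardsU -setIIr (_ : X :&: boundary X = set0) ?setI0;
  first by rewrite cards0 subn0.
by apply/setP => y; rewrite !inE; case: (y \in X).
Qed.

Lemma separating_far X : separating X -> separating (far X).
Proof.
move=> /andP[/set0Pn[x xX] fX]; rewrite /separating fX /=.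
by apply/set0Pn; exists x; apply: (subsetP (sub_far_far X)).
Qed.

(** The far side of an atom has a boundary of the same, minimum size, so it
    competes with the atom for the number of elements. *)
Lemma atom_le_far A : atom A -> #|A| <= #|far A|.
Proof.
move=> [sA minA]; have [le_b ->//] := minA _ (separating_far sA).
by apply/eqP; rewrite eqn_leq le_b subset_leq_card // boundary_far.
Qed.

Lemma atom_cards A B : atom A -> atom B ->
  #|boundary A| = #|boundary B| /\ #|A| = #|B|.
Proof.
move=> [sA minA] [sB minB]; have [h1 h2] := minA _ sB; have [h3 h4] := minB _ sA.
by lia.
Qed.

(** This and [sub_boundaryU] are the two halves of the submodularity of the
    size of the boundary: counted with multiplicity, the six pieces on the two
    right-hand sides are exactly the pieces into which [Y] cuts [boundary X]
    and [X] cuts [boundary Y]. *)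
Lemma sub_boundaryI X Y : boundary (X :&: Y) \subset
  (boundary Y :&: X) :|: (boundary Y :&: boundary X) :|: (boundary X :&: Y).
Proof.
apply/subsetP => z; rewrite !inE => /andP[zXY /existsP[x /andP[]]].
rewrite inE => /andP[xX xY] exz.
have hX : [exists x in X, e x z] by apply/existsP; exists x; rewrite xX.
have hY : [exists x in Y, e x z] by apply/existsP; exists x; rewrite xY.
by move: zXY; rewrite hX hY; case: (z \in X); case: (z \in Y).
Qed.

Lemma sub_boundaryU X Y : boundary (X :|: Y) \subset
  (boundary X :&: boundary Y) :|: (boundary X :&: far Y) :|: (boundary Y :&: far X).
Proof.
apply/subsetP => z; rewrite 2!in_setU 3!in_setI !in_far !in_boundary.
rewrite in_setU negb_or => /andP[/andP[-> ->] /existsP[x /andP[]]] /=.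
rewrite inE => /orP[] xP exz.
- have -> /= : [exists x in X, e x z] by apply/existsP; exists x; rewrite xP.
  by case: [exists x in Y, e x z].
- have -> /= : [exists x in Y, e x z] by apply/existsP; exists x; rewrite xP.
  by case: [exists x in X, e x z].
Qed.

Lemma card_setU3 X Y Z : #|X :|: Y :|: Z| <= #|X| + #|Y| + #|Z|.
Proof.
by apply: leq_trans (leq_card_setU _ _) _; rewrite leq_add2r leq_card_setU.
Qed.

(** The intersection of two crossing atoms is separating but smaller than an
    atom, so its boundary is strictly larger than [boundary B].  On the other
    hand [sub_boundaryI] bounds it by [boundary B] with the part in [far A]
    replaced by the part of [boundary A] in [B]. *)
Lemma crossing_atoms A B : atom A -> atom B -> A :&: B != set0 -> A != B ->
  #|boundary B :&: far A| < #|B :&: boundary A|.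
Proof.
move=> aA aB AB0 neqAB; have [eqb eqc] := atom_cards aA aB.
have ltI : #|A :&: B| < #|A|.
  apply: proper_card; rewrite properEneq subsetIl andbT.
  apply: contra neqAB => /eqP/setIidPl sAB.
  by rewrite eqEcard sAB eqc leqnn.
have sI : separating (A :&: B).
  rewrite /separating AB0 /=; case: aA => /andP[_ /set0Pn[x xA]] _.
  by apply/set0Pn; exists x; apply: (subsetP (far_antimono (subsetIl A B))).
have [le_b eq_b] := (proj2 aA) _ sI.
have lt_b : #|boundary A| < #|boundary (A :&: B)|.
  by rewrite ltn_neqAle le_b andbT; apply/eqP => h; have := eq_b (esym h); lia.
have := subset_leq_card (sub_boundaryI A B).
have := card_setU3 (boundary B :&: A) (boundary B :&: boundary A) (boundary A :&: B).
have := card_trisect A (boundary B).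
rewrite [B :&: _]setIC; lia.
Qed.

(** If the far sides of two crossing atoms are disjoint, then [far A] lies in
    [B] and its boundary, and [crossing_atoms] makes it smaller than [B],
    against [atom_le_far].  Otherwise the union is separating, and
    [sub_boundaryU] with [crossing_atoms] makes its boundary smaller than that
    of an atom. *)
Lemma atoms_disjoint A B : atom A -> atom B -> A :&: B != set0 -> A = B.
Proof.
move=> aA aB AB0; apply/eqP; apply/idPn => neqAB.
have [eqb eqc] := atom_cards aA aB.
have cAB := crossing_atoms aA aB AB0 neqAB.
have cBA : #|boundary A :&: far B| < #|A :&: boundary B|.
  by apply: (crossing_atoms aB aA); [rewrite setIC|rewrite eq_sym].
have AB_gt0 : 0 < #|A :&: B| by rewrite card_gt0.
have [far0|farN0] := eqVneq (far A :&: far B) set0.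
  have := atom_le_far aA; rewrite (card_trisect B (far A)) far0 cards0.
  have := card_trisect A B.
  rewrite [far A :&: B]setIC [far A :&: boundary B]setIC [B :&: A]setIC; lia.
have sU : separating (A :|: B).
  apply/andP; split.
    have /set0Pn[x] := AB0; rewrite inE => /andP[xA _].
    by apply/set0Pn; exists x; rewrite inE xA.
  have /set0Pn[x] := farN0; rewrite inE => /andP[xA xB].
  apply/set0Pn; exists x; move: xA xB; rewrite !in_far => /andP[xA nA] /andP[xB nB].
  rewrite inE negb_or xA xB /=; apply/existsP => -[y /andP[]].
  rewrite inE => /orP[] yP exy.
    by case/existsP: nA; exists y; rewrite yP.
  by case/existsP: nB; exists y; rewrite yP.
have [le_b _] := (proj2 aA) _ sU.
have := subset_leq_card (sub_boundaryU A B).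
have := card_setU3 (boundary A :&: boundary B) (boundary A :&: far B) (boundary B :&: far A).
have := card_trisect B (boundary A); have := card_trisect A (boundary B).
rewrite [boundary A :&: B]setIC [boundary B :&: A]setIC; lia.
Qed.

Lemma atom_exists X : separating X -> exists A, atom A.
Proof.
move=> sX; have [B sB minB] := arg_minnP (fun Y => #|boundary Y|) sX.
have PB : separating B && (#|boundary B| == #|boundary B|) by rewrite sB eqxx.
pose P Y := separating Y && (#|boundary Y| == #|boundary B|).
have [A /andP[sA /eqP bA] minA] := arg_minnP (P := P) (fun Y => #|Y|) PB.
exists A; split => // Y sY; rewrite bA; split; first exact: minB.
by move=> bY; apply: minA; rewrite /P sY bY eqxx.
Qed.

Section Automorphism.
Variable f : T -> T.
Hypothesis (f_inj : injective f) (f_edge : forall x y, e (f x) (f y) = e x y).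

Lemma boundary_imset X : boundary (f @: X) = f @: boundary X.
Proof.
apply/setP => z; have [g _ gK] := injF_bij f_inj; rewrite -(gK z).
rewrite (mem_imset _ _ f_inj) !in_boundary (mem_imset _ _ f_inj); congr (_ && _).
apply/existsP/existsP => -[x /andP[xX exy]].
  by case/imsetP: xX exy => y yX -> ; rewrite f_edge => h; exists y; rewrite yX.
by exists (f x); rewrite (mem_imset _ _ f_inj) xX f_edge.
Qed.

Lemma separating_imset X : separating X -> separating (f @: X).
Proof.
have [g _ gK] := injF_bij f_inj.
move=> /andP[/set0Pn[x xX] /set0Pn[y yX]]; apply/andP; split; apply/set0Pn.
  by exists (f x); apply: imset_f.
exists (f y); move: yX; rewrite !in_setC !in_setU !negb_or.
by rewrite boundary_imset !(mem_imset _ _ f_inj).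
Qed.

Lemma atom_imset A : atom A -> atom (f @: A).
Proof.
move=> [sA minA]; split; first exact: separating_imset.
by move=> X sX; rewrite boundary_imset !card_imset //; apply: minA.
Qed.

(** The image of [A] is an atom that meets [A] in [x], so it is [A]. *)
Lemma atom_stable A x : atom A -> x \in A -> f x = x ->
  {in A, forall y, f y \in A}.
Proof.
move=> aA xA fx y yA; rewrite (atoms_disjoint aA (atom_imset aA)) ?imset_f //.
by apply/set0Pn; exists x; rewrite inE xA -{1}fx imset_f.
Qed.

End Automorphism.

(** If deleting [S] disconnects [x] from [y], take for [X] the component of
    [x]: a vertex that is adjacent to it from outside has been deleted, and [y]
    lies on the far side. *)
Lemma disconnecting_boundary S : disconnecting e S ->
  exists2 X, separating X & boundary X \subset S.
Proof.
move=> /existsP[x /existsP[y /and3P[xS yS nxy]]].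
pose X := [set z | connect (del e S) x z].
have avoid z : z \in X -> z \notin S.
  rewrite inE => /connectP[p]; elim/last_ind: p => [_ -> //|p w _].
  by rewrite rcons_path last_rcons => /andP[_ /and3P[]] _ wS _ ->.
have sub : boundary X \subset S.
  apply/subsetP => w; rewrite in_boundary => /andP[wX /existsP[z /andP[zX ezw]]].
  apply/idPn => wS; move: wX; rewrite inE; case/negP.
  have:= zX; rewrite inE => /connect_trans; apply; apply: connect1.
  by apply/and3P; split => //; apply: avoid.
exists X => //; apply/andP; split; apply/set0Pn.
  by exists x; rewrite inE connect0.
exists y; rewrite in_setC in_setU negb_or (contra (subsetP sub y) yS) andbT.
by rewrite inE nxy.
Qed.

(** All the neighbours of a vertex of an atom without edges lie in the boundary
    of the atom. *)
Lemma edgeless_atoms_bound d S :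
  (forall x, degree e x = d) ->
  (forall A, atom A -> {in A &, forall x y, ~~ e x y}) ->
  disconnecting e S -> d <= #|S|.
Proof.
move=> reg edgeless /disconnecting_boundary[X sX bXS].
have [A aA] := atom_exists sX.
apply: leq_trans (subset_leq_card bXS).
case: (aA) => sA /(_ _ sX)[bAX _]; apply: leq_trans bAX.
have /andP[/set0Pn[x xA] _] := sA.
rewrite -(reg x) subset_leq_card //; apply/subsetP => y; rewrite inE => exy.
rewrite in_boundary; apply/andP; split.
  by apply: contraL exy => yA; apply: edgeless aA _ _ xA yA.
by apply/existsP; exists x; rewrite xA.
Qed.

Lemma neighbours_disconnect x y : ~~ e x x -> x != y -> ~~ e x y ->
  disconnecting e [set z | e x z].
Proof.
move=> nxx neq nxy; apply/existsP; exists x; apply/existsP; exists y.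
rewrite !inE nxx nxy /=; apply/connectP => -[[|z p] /=].
  by move=> _ yx; rewrite yx eqxx in neq.
by move=> /andP[/and3P[_]]; rewrite inE => /negP.
Qed.

Lemma connectivity_le S : disconnecting e S -> connectivity e <= #|S|.
Proof.
rewrite /connectivity -big_filter => dS.
have : S \in [seq S <- index_enum {set T} | disconnecting e S].
  by rewrite mem_filter dS mem_index_enum.
elim: [seq _ <- _ | _] => // B r IH; rewrite inE big_cons geq_min.
by case/predU1P => [->|/IH ->]; rewrite ?leqnn ?orbT.
Qed.

Lemma connectivity_ge d : d <= #|T|.-1 ->
  (forall S, disconnecting e S -> d <= #|S|) -> d <= connectivity e.
Proof.
move=> dT dS; apply: (big_ind (fun m => d <= m)) => // a b.
by rewrite leq_min => -> ->.
Qed.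

End Atoms.

(** * Transpositions acting on subsets *)

Section Transpositions.
Variable T : finType.
Implicit Types (a b c : T) (U V W : {set T}).

Lemma tperm_imset_same a b U : (a \in U) = (b \in U) -> tperm a b @: U = U.
Proof.
move=> ab; apply/setP => x; rewrite -{1}(tpermK a b x) (mem_imset _ _ perm_inj).
by case: tpermP => [->|->|].
Qed.

Lemma tperm_imset_move a b U : a \in U -> b \notin U ->
  tperm a b @: U = b |: U :\ a.
Proof.
move=> aU bU; apply/setP => x; rewrite -{1}(tpermK a b x) (mem_imset _ _ perm_inj).
rewrite !inE; case: tpermP => [->|->|/eqP xa /eqP xb].
- by rewrite eqxx (negPf bU) /=; case: eqVneq => // h; rewrite -h aU in bU.
- by rewrite eqxx aU.
- by rewrite (negPf xb) xa.
Qed.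

(** Transpositions generate the symmetric group, which is transitive on the
    subsets of a given cardinality.  Concretely, exchanging an element of
    [U :\: W] with one of [W :\: U] brings [U] closer to [W]. *)
Lemma tperm_transitive (F : {set T} -> Prop) U W :
  (forall a b V, F V -> F (tperm a b @: V)) ->
  #|U| = #|W| -> F U -> F W.
Proof.
move=> Ft; move: {2}#|_| (leqnn #|W :\: U|) => m; elim: m U => [|m IH] U hm cUW FU.
  move: hm; rewrite leqn0 cards_eq0 setD_eq0 => sWU.
  by rewrite (_ : W = U) //; apply/eqP; rewrite eqEcard sWU cUW /=.
have cD : #|U :\: W| = #|W :\: U|.
  by have := cardsID W U; have := cardsID U W; rewrite setIC; lia.
have [/eqP|] := eqVneq #|W :\: U| 0.
  by move=> /eqP h; apply: IH FU => //; rewrite h.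
rewrite -lt0n => gt0; have : 0 < #|U :\: W| by rewrite cD.
move: (gt0); rewrite !card_gt0 => /set0Pn[b]; rewrite inE => /andP[bU bW].
move=> /set0Pn[a]; rewrite inE => /andP[aW aU].
apply: (IH (tperm a b @: U)); last exact: Ft.
  suff : W :\: tperm a b @: U \proper W :\: U.
    by move/proper_card => h; rewrite -ltnS (leq_trans h).
  rewrite tperm_imset_move //; apply/properP; split.
    apply/subsetP => x; rewrite !inE negb_or negb_and negbK.
    move=> /andP[/andP[xb /orP[/eqP ->|->]] xW //].
    by rewrite xW in aW.
  by exists b; rewrite !inE ?bU ?bW ?eqxx.
by rewrite card_imset //; apply: perm_inj.
Qed.

Lemma tperm_conj a b c : a != b -> c != a -> c != b ->
  tperm a b = (tperm a c * (tperm c b * tperm a c))%g.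
Proof.
move=> ab ca cb; rewrite -{1}(tpermV a c) -/(conjg _ _) tpermJ tpermR.
by rewrite tpermD // eq_sym.
Qed.

End Transpositions.

(** * The bipartite Kneser graph *)

Section BipartiteKneserGraph.
Variables (n k : nat).
Hypothesis (hk : 1 <= k) (hn : 2 * k + 1 <= n).
Local Notation V := (bkneser_vertex n k).

Lemma bkneser_perm_subproof (s : {perm 'I_n}) (u : V) :
  (#|s @: val u| == k) || (#|s @: val u| == n - k).
Proof. by rewrite card_imset ?(valP u) //; apply: perm_inj. Qed.

Definition bkneser_perm (s : {perm _}) (u : V) : V :=
  Sub (s @: val u) (bkneser_perm_subproof s u).

Lemma bkneser_perm_inj s : injective (bkneser_perm s).
Proof.
move=> u v /(congr1 val) /= uv; apply: val_inj.
exact: (imset_inj perm_inj uv).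
Qed.

Lemma imset_subset (s : {perm 'I_n}) (U W : {set 'I_n}) :
  (s @: U \subset s @: W) = (U \subset W).
Proof.
apply/idP/idP => [/subsetP sub|]; last exact: imsetS.
apply/subsetP => x xU; rewrite -(mem_imset _ _ (@perm_inj _ s)).
by apply: sub; apply: imset_f.
Qed.

Lemma bkneser_perm_edge s u v :
  bkneser (bkneser_perm s u) (bkneser_perm s v) = bkneser u v.
Proof.
by rewrite /bkneser /= !imset_subset (inj_eq (@bkneser_perm_inj s)).
Qed.

Lemma bkneser_permM s t u :
  bkneser_perm (s * t)%g u = bkneser_perm t (bkneser_perm s u).
Proof.
apply: val_inj; rewrite /= -imset_comp; apply: eq_imset => x /=.
by rewrite permM.
Qed.

(** Orienting an edge by inclusion also determines the cardinalities of its
    ends, since [k < n - k]. *)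
Lemma bkneser_edgeP (u v : V) : bkneser u v ->
  exists x y : V, [/\ (x = u /\ y = v) \/ (x = v /\ y = u), #|val x| = k,
    #|val y| = n - k & val x \subset val y].
Proof.
wlog suff : u v / val u \proper val v -> exists x y : V,
    [/\ (x = u /\ y = v) \/ (x = v /\ y = u), #|val x| = k,
       #|val y| = n - k & val x \subset val y].
  move=> H /andP[neq /orP[] sub].
    by apply: H; rewrite properEneq sub andbT.
  have [|x [y [h *]]] := H v u; first by rewrite properEneq sub andbT eq_sym.
  by exists x, y; split => //; case: h => -[-> ->]; [right|left].
move=> lt; exists u, v; have := proper_card lt.
case/orP: (valP u) => /eqP cu; case/orP: (valP v) => /eqP cv;
  rewrite cu cv => h; try by lia.
by split=> //; [left|exact: proper_sub].
Qed.

(** For an edge [U \subset W] in an atom, a transposition fixes [U] or [W]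
    unless it exchanges some [a] in [U] with some [b] outside [W].  In that
    case choose [c] in [W :\: U]: the transposition of [a] and [b] is the
    conjugate of that of [c] and [b], which fixes [U], by that of [a] and [c],
    which fixes [W]. *)
Lemma bkneser_atom_edgeless A : atom (@bkneser n k) A ->
  {in A &, forall u v, ~~ bkneser u v}.
Proof.
move=> aA u0 v0 u0A v0A; apply/negP => /bkneser_edgeP[u [v [uv cu cv sub]]].
have [uA vA] : u \in A /\ v \in A by case: uv => -[-> ->].
pose stab s := {in A, forall x, bkneser_perm s x \in A}.
have stab_fix s x : x \in A -> bkneser_perm s x = x -> stab s.
  move=> xA; apply: (atom_stable _ _ _ aA xA).
  - exact: bkneser_sym.
  - exact: bkneser_perm_inj.
  - exact: bkneser_perm_edge.
have stabM s t : stab s -> stab t -> stab (s * t)%g.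
  by move=> ss st x xA; rewrite bkneser_permM; apply/st/ss.
have stab_same x a b : x \in A -> (a \in val x) = (b \in val x) -> stab (tperm a b).
  move=> xA ab; apply: (stab_fix _ x xA); apply: val_inj.
  exact: tperm_imset_same.
have [c cNu cv'] : exists2 c, c \notin val u & c \in val v.
  have : ~~ (val v \subset val u).
    by apply/negP => /subset_leq_card; rewrite cu cv; lia.
  by case/subsetPn => c cv' cu'; exists c.
have stab_uv a b : a \in val u -> b \notin val v -> stab (tperm a b).
  move=> au bv; have av := subsetP sub _ au.
  have bu : b \notin val u by apply: contra bv; apply: (subsetP sub).
  rewrite (@tperm_conj _ a b c).
  - have ac : stab (tperm a c) by apply: (stab_same v) => //; rewrite av cv'.
    apply: (stabM) => //; apply: stabM => //; apply: (stab_same u) => //.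
    by rewrite (negPf cNu) (negPf bu).
  - by apply: contraNneq bu => <-.
  - by apply: contraNneq cNu => ->.
  - by apply: contraNneq bv => <-.
have stab_all a b : stab (tperm a b).
  have [h|] := eqVneq (a \in val u) (b \in val u); first exact: (stab_same u).
  have [h|] := eqVneq (a \in val v) (b \in val v); first by move=> _; exact: (stab_same v).
  have := subsetP sub a; have := subsetP sub b.
  case au: (a \in val u); case bu: (b \in val u) => //= hb ha.
    case: (boolP (b \in val v)) => [|bv _ _]; last exact: stab_uv.
    by rewrite ha.
  case: (boolP (a \in val v)) => [|av _ _]; last by rewrite tpermC; exact: stab_uv.
  by rewrite hb.
(* The atom has a vertex of each cardinality, so transitivity reaches all. *)
have full w : w \in A.
  have tr x : x \in A -> #|val x| = #|val w| -> w \in A.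
    move=> xA cxw; have [z zA zw] : exists2 z, z \in A & val z = val w.
      apply: (tperm_transitive (F := fun W => exists2 z, z \in A & val z = W) _ cxw).
        by move=> a b W [z zA <-]; exists (bkneser_perm (tperm a b) z) => //; apply: stab_all.
      by exists x.
    by rewrite -(val_inj zw).
  case/orP: (valP w) => /eqP cw; first by apply: (tr u) => //; rewrite cu cw.
  by apply: (tr v) => //; rewrite cv cw.
have [/andP[_ /set0Pn[w wA]] _] := aA.
by move: wA; rewrite in_far full.
Qed.

(** Both kinds of neighbourhoods are counted as the [k]-subsets of a set with
    [n - k] elements: directly below a large vertex, and through complements
    above a small one. *)
Lemma bkneser_degree (u : V) : degree (@bkneser n k) u = 'C(n - k, k).
Proof.
have /orP[/eqP cu|/eqP cu] := valP u.
- have cCu : #|~: val u| = n - k by rewrite cardsCs setCK card_ord cu.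
  rewrite -[in RHS]cCu -cards_draws /degree -(card_imset _ (inj_comp (@setC_inj _) val_inj)).
  apply: eq_card => W; rewrite inE; apply/imsetP/andP => [[v]|[sub /eqP cW]].
    rewrite inE => /bkneser_edgeP[x [y [h cx cy sub]]] -> /=.
    move: cx cy sub; case: h => -[-> ->]; last by lia.
    by move=> _ cv sub; rewrite setCS sub cardsCs setCK card_ord cv; split=> //; lia.
  have cC : #|~: W| = n - k by rewrite cardsCs setCK card_ord cW.
  have pW : (#|~: W| == k) || (#|~: W| == n - k) by rewrite cC eqxx orbT.
  exists (Sub (~: W) pW); last by rewrite /= setCK.
  rewrite inE /bkneser /= -setCS setCK sub /= andbT.
  by apply/eqP => /(congr1 (fun x : V => #|val x|)) /=; rewrite cC cu; lia.
- rewrite -[in RHS]cu -cards_draws /degree -(card_imset _ val_inj).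
  apply: eq_card => W; rewrite inE; apply/imsetP/andP => [[v]|[sub /eqP cW]].
    rewrite inE => /bkneser_edgeP[x [y [h cx cy sub]]] -> /=.
    move: cx cy sub; case: h => -[-> ->]; first by lia.
    by move=> -> _ ->; rewrite eqxx.
  have pW : (#|W| == k) || (#|W| == n - k) by rewrite cW eqxx.
  exists (Sub W pW) => //; rewrite inE /bkneser /= sub orbT andbT.
  by apply/eqP => /(congr1 (fun x : V => #|val x|)) /=; rewrite cW cu; lia.
Qed.

Lemma bkneser_other_vertex (u : V) : exists2 v : V, u != v & ~~ bkneser u v.
Proof.
have [a au] : exists a, a \in val u.
  by apply/set0Pn; rewrite -card_gt0; have /orP := valP u; lia.
have [b bu] : exists b, b \notin val u.
  have : 0 < #|~: val u| by rewrite cardsCs setCK card_ord; have /orP := valP u; lia.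
  by rewrite card_gt0 => /set0Pn[b]; rewrite inE; exists b.
have neq : val u != tperm a b @: val u.
  by apply: contraNneq bu => ->; rewrite -{1}(tpermL a b) imset_f.
exists (bkneser_perm (tperm a b) u); first by rewrite -val_eqE.
apply/negP => /bkneser_edgeP[x [y [h cx cy _]]].
have cuv : #|tperm a b @: val u| = #|val u| by apply: card_imset; apply: perm_inj.
by move: cx cy; case: h => -[-> ->]; rewrite cuv => ->; lia.
Qed.

Lemma bkneser_connectivity (u : V) : connectivity (@bkneser n k) = 'C(n - k, k).
Proof.
have irr : ~~ bkneser u u by rewrite bkneser_irr.
apply/eqP; rewrite eqn_leq; apply/andP; split.
  rewrite -(bkneser_degree u); have [v neq nuv] := bkneser_other_vertex u.
  by apply: connectivity_le; apply: neighbours_disconnect neq nuv.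
apply: connectivity_ge.
  (* The default value in [connectivity] is no obstacle: no vertex is its own
     neighbour. *)
  rewrite -(bkneser_degree u) (cardD1 u) /= subset_leq_card //.
  apply/subsetP => v; rewrite !inE => h; rewrite andbT.
  by apply: contraTneq h => ->.
move=> S; apply: edgeless_atoms_bound; first exact: bkneser_degree.
exact: bkneser_atom_edgeless.
Qed.

End BipartiteKneserGraph.

Theorem corollary3p3 (n k : nat) (hk : 1 <= k) (hn : 2 * k + 1 <= n) :
  maximum_connectivity (@bkneser n k) /\
  connectivity (@bkneser n k) = 'C(n - k, k).
Proof.
split=> [u|]; first by rewrite bkneser_degree // bkneser_connectivity.
have [U] : exists U : {set 'I_n}, U \in [set B : {set 'I_n} | (B \subset setT) & (#|B| == k)].
  by apply/set0Pn; rewrite -card_gt0 cards_draws cardsT card_ord bin_gt0; lia.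
rewrite inE subsetT /= => cU.
have pU : (#|U| == k) || (#|U| == n - k) by rewrite cU.
exact: (bkneser_connectivity hk hn (Sub U pU)).
Qed.
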